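(* Consider the equation $$(1+\sqrt{-D})^r = a \pm \sqrt{-D},$$ where $D$ and $r$ are positive integers, $a$ is an integer, and the sign $\pm$ may be either sign. (1) If $D$ is a positive integer with $D \equiv 2 \pmod 4$ and $a$ is any integer, then the equation has no solutions with $r>1$, except for $D=2$, $r=3$. (2) If $D$ is a positive integer with $D \equiv 0 \pmod 4$ such that $1+D$ is a prime or a prime power, then the equation has no solutions with $r>1$ (for any integer $a$), except for $D=4$, $r=3$.
   Context: $D$ is not assumed to be squarefree. $\sqrt{-D}$ denotes a fixed complex square root of $-D$. *)

(* Defs.v *)
From HB Require Import structures.
From mathcomp Require Import all_boot all_order all_algebra.
From mathcomp Require Import reals.
From mathcomp Require Import complex.

Set Implicit Arguments.
Unset Strict Implicit.
Unset Printing Implicit Defensive.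

Import Order.TTheory GRing.Theory Num.Theory.
Local Open Scope ring_scope.

(* [s] stands for the chosen complex square root of [- D]. *)
Definition is_solution (R : realType) (s : R[i]) (r : nat) (a : int) : Prop :=
  (1 + s) ^+ r = a%:~R + s \/ (1 + s) ^+ r = a%:~R - s.

Definition prime_power (n : nat) : Prop :=
  exists p k : nat, [/\ prime p, (0 < k)%N & n = (p ^ k)%N].

(* Main.v *)
Require Import Defs.
From HB Require Import structures.
From mathcomp Require Import all_boot all_order all_algebra.
From mathcomp Require Import reals.
From mathcomp Require Import complex.
From mathcomp Require Import zify ring.
From mathcomp Require Import cyclic.

Set Implicit Arguments.
Unset Strict Implicit.
Unset Printing Implicit Defensive.

Import Order.TTheory GRing.Theory Num.Theory.
Local Open Scope ring_scope.

(** Put [alpha = 1 + sqrt (- D)] and [alpha ^ n = x_n + y_n sqrt (- D)]; the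
equation says [y_r = 1] or [y_r = -1].  Since [y_(2h) = 2 x_h y_h], such an
[r] is odd, [r = 2 h + 1].

The case [y_r = 1] is local at a prime [p] dividing [D]: writing
[alpha ^ p = 1 + p t] (or [alpha ^ 4 = 1 + 4 t] for [p = 2]), a positive power
of it moves the second coordinate [p]-adically by exactly its first-order
term.  This excludes every prime [p > 3], then [3], then [4 | D], and for
[D = 2] it isolates [r = 3].

In the case [y_r = -1], [y_r = 2 ^ (2 h)] modulo [D + 1] makes [-1] a square
modulo [D + 1], which is absurd if [D = 2] modulo [4].  If [4 | D] and
[D + 1 = p ^ k], then [r = -1] modulo [D] shows that [h] is odd and prime to
[D], hence to [p - 1], while [(-4) ^ h = 1] modulo [p ^ k]; so [-4 = 1] modulo
[p], i.e. [p = 5].  If [k = 1] then [D = 4] and the 2-adic argument gives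
[r = 3].  If [k > 1], looking modulo [25] gives [5 | h], so [y_5 | y_h].  Now
[y_r = -1] is the negative Pell equation
[(x_h + y_h) ^ 2 - 5 ^ k y_h ^ 2 = -1], which is impossible for even [k]; for
odd [k], with [v = 5 ^ ((k - 1) / 2)], the Aurifeuillian factorization
[y_5 = (5 (v - 1) ^ 2 - 1) (5 (v + 1) ^ 2 - 1)] exhibits a divisor of
[(x_h + y_h) ^ 2 + 1] that is [3] modulo [4]. *)

(* The pair [(a, b)] stands for [a + b sqrt d]. *)
Definition zsqrt (d : int) : Type := (int * int)%type.

HB.instance Definition _ (d : int) :=
  GRing.Zmodule.copy (zsqrt d) (int * int)%type.

(** * The ring of integer combinations of 1 and a square root of [d] *)

Section ZsqrtRing.

Variable d : int.

Definition zsqrt_one : zsqrt d := (1, 0).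

Definition zsqrt_mul (u v : zsqrt d) : zsqrt d :=
  (u.1 * v.1 + d * (u.2 * v.2), u.1 * v.2 + u.2 * v.1).

Fact zsqrt_mulA : associative zsqrt_mul.
Proof. by move=> [a b] [c e] [f g]; congr pair => /=; ring. Qed.

Fact zsqrt_mulC : commutative zsqrt_mul.
Proof. by move=> [a b] [c e]; congr pair => /=; ring. Qed.

Fact zsqrt_mul1 : left_id zsqrt_one zsqrt_mul.
Proof. by move=> [a b]; congr pair => /=; ring. Qed.

Fact zsqrt_mulDl : left_distributive zsqrt_mul +%R.
Proof. by move=> [a b] [c e] [f g]; congr pair => /=; ring. Qed.

Fact zsqrt_one_neq0 : zsqrt_one != 0.
Proof. by []. Qed.

HB.instance Definition _ := GRing.Zmodule_isComNzRing.Build (zsqrt d)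
  zsqrt_mulA zsqrt_mulC zsqrt_mul1 zsqrt_mulDl zsqrt_one_neq0.

Lemma zsqrtM1 (u v : zsqrt d) : (u * v).1 = u.1 * v.1 + d * (u.2 * v.2).
Proof. by []. Qed.

Lemma zsqrtM2 (u v : zsqrt d) : (u * v).2 = u.1 * v.2 + u.2 * v.1.
Proof. by []. Qed.

Lemma zsqrtD1 (u v : zsqrt d) : (u + v).1 = u.1 + v.1.
Proof. by []. Qed.

Lemma zsqrtD2 (u v : zsqrt d) : (u + v).2 = u.2 + v.2.
Proof. by []. Qed.

Lemma zsqrt_nat (n : nat) : (n%:R : zsqrt d) = (n%:Z, 0).
Proof.
elim: n => [//|n IH]; rewrite -natr1 IH.
by congr pair => /=; lia.
Qed.

Lemma dvdz_snd_exp (u : zsqrt d) (n : nat) : (u.2 %| (u ^+ n).2)%Z.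
Proof.
elim: n => [|n IH]; first by rewrite expr0 dvdz0.
by rewrite exprS zsqrtM2; apply: rpredD; [exact: dvdz_mull | exact: dvdz_mulr].
Qed.

End ZsqrtRing.

(** * Powers of [1 + M t] to first order, [p]-adically *)

Section BinomialCongruence.

Variable A : comNzRingType.

Lemma expr1D_order3 (x : A) (n : nat) :
  exists w, (1 + x) ^+ n = 1 + n%:R * x + 'C(n, 2)%:R * x ^+ 2 + x ^+ 3 * w.
Proof.
elim: n => [|n [w IH]]; first by exists 0; rewrite expr0 bin0n /=; ring.
exists ('C(n, 2)%:R + (1 + x) * w).
by rewrite exprS IH binS bin1 natrD -natr1; ring.
Qed.

(** The two hypotheses put the quadratic and higher binomial terms in [p ^ 2 * M]. For odd [p],
    [M = p] will do; for [p = 2] they force [4 | M]. *)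
Lemma expr1D_step (p M : nat) (t : A) :
    (p %| M)%N -> (p ^ 2 %| 'C(p, 2) * M)%N ->
  exists w, (1 + M%:R * t) ^+ p = 1 + (p * M)%:R * (t + p%:R * w).
Proof.
move=> /dvdnP[b Mb] /dvdnP[a Ca].
have [w ->] := expr1D_order3 (M%:R * t) p.
exists (a%:R * t ^+ 2 + b%:R ^+ 2 * t ^+ 3 * w).
have E : 'C(p, 2)%:R * M%:R = a%:R * p%:R ^+ 2 :> A.
  by rewrite -natrM Ca natrM natrX.
have -> : 'C(p, 2)%:R * (M%:R * t) ^+ 2
    = ('C(p, 2)%:R * M%:R) * (M%:R * t ^+ 2) :> A by ring.
rewrite E natrM Mb natrM; ring.
Qed.

Lemma expr1D_pow (p e M : nat) (t : A) :
    (p %| M)%N -> (p ^ 2 %| 'C(p, 2) * M)%N ->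
  exists w, (1 + M%:R * t) ^+ (p ^ e) = 1 + (p ^ e * M)%:R * (t + p%:R * w).
Proof.
move=> pM cM; elim: e => [|e [w IH]]; first by exists 0; rewrite mul1n; ring.
rewrite expnSr exprM IH.
have [||w' ->] := @expr1D_step p (p ^ e * M) (t + p%:R * w).
- exact: dvdn_mull.
- by rewrite mulnCA dvdn_mull.
exists (w + w'); rewrite mulnA -expnS expnSr.
by congr (1 + _ * _); ring.
Qed.

Lemma expr1D_val (p e k M : nat) (t : A) :
    (p %| M)%N -> (p ^ 2 %| 'C(p, 2) * M)%N ->
  exists w, (1 + M%:R * t) ^+ (p ^ e * k)
            = 1 + (p ^ e * M)%:R * (k%:R * t + p%:R * w).
Proof.
move=> pM cM; have [w E] := expr1D_pow e t pM cM.
rewrite exprM E; set N := (p ^ e * M)%N; set t' := t + _.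
have [v ->] := expr1D_order3 (N%:R * t') k.
have /dvdnP[b Nb] : (p %| N)%N by rewrite dvdn_mull.
exists (k%:R * w + b%:R * ('C(k, 2)%:R * t' ^+ 2 + N%:R * t' ^+ 3 * v)).
set Z := (_ * t' ^+ 2 + _).
have -> : 1 + k%:R * (N%:R * t') + 'C(k, 2)%:R * (N%:R * t') ^+ 2
    + (N%:R * t') ^+ 3 * v = 1 + N%:R * (k%:R * t' + N%:R * Z).
  by rewrite /Z; ring.
have -> : N%:R * Z = b%:R * p%:R * Z by rewrite Nb natrM.
by rewrite /t'; ring.
Qed.

End BinomialCongruence.

(* Local uniqueness: raising [1 + M t] to a positive power moves the second
   coordinate of [g] by [p ^ e M] times a [p]-adic unit, unless [p]
   divides the first-order term [(g t).2]. *)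
Lemma snd_exp_stationary (d : int) (p M m : nat) (g t : zsqrt d) :
    prime p -> (0 < M)%N -> (p %| M)%N -> (p ^ 2 %| 'C(p, 2) * M)%N ->
    (0 < m)%N -> (g * (1 + M%:R * t) ^+ m).2 = g.2 ->
  (p%:Z %| (g * t).2)%Z.
Proof.
move=> p_pr M0 pM cM m0.
have [k pk mE] := pfactor_coprime p_pr m0.
set e := logn p m in mE; rewrite mE mulnC.
have [w ->] := expr1D_val e k t pM cM.
set N := (p ^ e * M)%N.
have N0 : (0 < N)%N by rewrite muln_gt0 expn_gt0 prime_gt0.
have -> : g * (1 + N%:R * (k%:R * t + p%:R * w))
    = g + N%:R * (k%:R * (g * t) + p%:R * (g * w)) by ring.
(* Cancelling [g.2] and then [N] leaves [k (g t).2 + p (g w).2 = 0] with [k] prime to [p]. *)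
rewrite zsqrtD2 -[RHS]addr0 => /addrI.
rewrite zsqrtM2 zsqrtD2 (zsqrtM2 k%:R) (zsqrtM2 p%:R) !zsqrt_nat /=.
rewrite !mul0r !addr0.
move/eqP; rewrite mulf_eq0 => /orP[/eqP|/eqP]; first by lia.
move/eqP; rewrite addr_eq0 => /eqP E.
suff : (p%:Z %| k%:Z * (g * t).2)%Z by rewrite Gauss_dvdzr.
by apply/dvdzP; exists (- (g * w).2); rewrite !zsqrtM2 E; ring.
Qed.

(** * Integer congruences, and -1 as a non-square *)

Lemma PoszX (a n : nat) : (a ^ n)%N%:Z = a%:Z ^+ n.
Proof. by elim: n => // n IH; rewrite expnS PoszM IH exprS. Qed.

Lemma dvdzN (m a : int) : (m %| - a)%Z = (m %| a)%Z.
Proof. by rewrite !dvdzE abszN. Qed.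

Lemma dvdz_subXX (m a b : int) (n : nat) :
  (m %| a - b)%Z -> (m %| a ^+ n - b ^+ n)%Z.
Proof. by move=> h; rewrite subrXX dvdz_mulr. Qed.

Lemma dvdz_fermat (p a : nat) :
  prime p -> coprime a p -> (p%:Z %| a%:Z ^+ p.-1 - 1)%Z.
Proof.
move=> p_pr ap; have := Euler_exp_totient ap.
rewrite totient_prime // => E.
by rewrite -eqz_mod_dvd -PoszX !modz_nat E.
Qed.

(** Bezout: [u i = v j + 1] gives [a = a * a ^ (v j) = a ^ (u i) = 1] modulo [m]. *)
Lemma dvdz_exp_coprime (m a : int) (i j : nat) :
    (0 < i)%N -> coprime i j ->
  (m %| a ^+ i - 1)%Z -> (m %| a ^+ j - 1)%Z -> (m %| a - 1)%Z.
Proof.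
move=> i0 ij hi hj; case: (egcdnP j i0) => u v E _.
rewrite (eqP ij) in E.
have hu : (m %| (a ^+ i) ^+ u - 1 ^+ u)%Z by apply: dvdz_subXX.
have hv : (m %| (a ^+ j) ^+ v - 1 ^+ v)%Z by apply: dvdz_subXX.
move: hu hv; rewrite !expr1n -!exprM mulnC E addn1 exprS (mulnC j) => hu hv.
have -> : a - 1 = (a * a ^+ (v * j) - 1) - a * (a ^+ (v * j) - 1) by ring.
by rewrite rpredB // dvdz_mull.
Qed.

Lemma prime_3mod4 (q : nat) :
  (q %% 4)%N = 3%N -> exists p, [/\ prime p, (p %| q)%N & (p %% 4)%N = 3%N].
Proof.
elim/ltn_ind: q => q IH q3.
have q1 : (1 < q)%N by lia.
have [p3|p3] := eqVneq (pdiv q %% 4)%N 3.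
  by exists (pdiv q); rewrite pdiv_prime // pdiv_dvd.
have [k qE] := dvdnP (pdiv_dvd q).
have p_pr := pdiv_prime q1.
have p1 := prime_gt1 p_pr.
have kq : (k < q)%N by nia.
have [p [? pk ?]] : exists p, [/\ prime p, (p %| k)%N & (p %% 4)%N = 3%N].
  apply: IH => //.
  have : ((k %% 4) * (pdiv q %% 4) %% 4)%N = 3%N by rewrite modnMm -qE.
  have := ltn_pmod k (isT : (0 < 4)%N); have := ltn_pmod (pdiv q) (isT : (0 < 4)%N).
  by move: (k %% 4)%N (pdiv q %% 4)%N p3 => [|[|[|[|?]]]] // [|[|[|[|?]]]].
by exists p; split=> //; rewrite qE dvdn_mulr.
Qed.

Lemma not_dvdz_sqrD1 (q : nat) (z : int) :
  (q %% 4)%N = 3%N -> ~~ (q%:Z %| z ^+ 2 + 1)%Z.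
Proof.
move=> /prime_3mod4[p [p_pr pq p3]]; apply/negP => qz.
have {qz pq}pz : (p%:Z %| z ^+ 2 + 1)%Z by apply: dvdz_trans qz.
have zE : z ^+ 2 = `|z|%N%:Z ^+ 2 by rewrite abszE real_normK ?num_real.
rewrite {}zE in pz; move: (`|z|%N) pz => {}z pz.
have zp : coprime z p.
  rewrite coprime_sym prime_coprime //; apply/negP => /dvdnP[c zc].
  have : (p%:Z %| 1)%Z.
    have -> : 1%Z = (z%:Z ^+ 2 + 1) - p%:Z * (c%:Z * z%:Z) by rewrite zc; lia.
    by rewrite rpredB // dvdz_mulr.
  by have := prime_gt1 p_pr; rewrite /dvdz => p1 /dvdn_leq; lia.
have := dvdz_fermat p_pr zp.
(* The exponent is [(p - 1) / 2], which is odd: [z ^ (p - 1) = -1], against Fermat. *)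
have : (p%:Z %| (z%:Z ^+ 2) ^+ (p %/ 4).*2.+1 - (-1) ^+ (p %/ 4).*2.+1)%Z.
  by apply: dvdz_subXX; rewrite opprK.
rewrite -exprM -signr_odd /= odd_double expr1.
have -> : (2 * (p %/ 4).*2.+1)%N = p.-1 by lia.
move=> h1 h2; have := rpredB h1 h2.
have -> : forall x : int, x - -1 - (x - 1) = 2%:Z by move=> x; ring.
by rewrite /dvdz /= => /dvdn_leq; lia.
Qed.

(** * Recurrences and congruences for the powers of [alpha] *)

Section Alpha.

Variable D : nat.

Definition sqrtmD : zsqrt (- D%:Z) := (0, 1).

Definition alpha : zsqrt (- D%:Z) := (1, 1).

Lemma alphaE : alpha = 1 + sqrtmD.
Proof. by []. Qed.

Lemma alpha_exp1S n : (alpha ^+ n.+1).1 = (alpha ^+ n).1 - D%:Z * (alpha ^+ n).2.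
Proof. by rewrite exprS zsqrtM1 /=; ring. Qed.

Lemma alpha_exp2S n : (alpha ^+ n.+1).2 = (alpha ^+ n).1 + (alpha ^+ n).2.
Proof. by rewrite exprS zsqrtM2 /=; ring. Qed.

Lemma alpha_exp3 : alpha ^+ 3 = (1 - 3 * D%:Z, 3 - D%:Z).
Proof. by rewrite !exprS expr0 mulr1; congr pair => /=; ring. Qed.

Lemma alpha_exp4 :
  alpha ^+ 4 = ((1 - D%:Z) ^+ 2 - 4 * D%:Z, 4 * (1 - D%:Z)).
Proof. by rewrite (exprM _ 2 2) !exprS !expr0 !mulr1; congr pair => /=; ring. Qed.

Lemma alpha_exp5_snd : (alpha ^+ 5).2 = D%:Z ^+ 2 - 10 * D%:Z + 5.
Proof. by rewrite alpha_exp2S alpha_exp4 /=; ring. Qed.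

Lemma alpha_exp_double_snd h :
  (alpha ^+ (2 * h)).2 = 2 * ((alpha ^+ h).1 * (alpha ^+ h).2).
Proof. by rewrite mulnC exprM expr2 zsqrtM2; ring. Qed.

Lemma alpha_exp_odd_snd h :
  (alpha ^+ (2 * h).+1).2 = ((alpha ^+ h).1 + (alpha ^+ h).2) ^+ 2
                            - (1 + D)%:Z * (alpha ^+ h).2 ^+ 2.
Proof.
by rewrite alpha_exp2S mulnC exprM !expr2 zsqrtM1 zsqrtM2 PoszD; ring.
Qed.

(** Modulo [D], [sqrtmD] squares to 0, so [alpha ^ n = 1 + n sqrtmD]. *)
Lemma alpha_exp_modD n :
  (D%:Z %| (alpha ^+ n).1 - 1)%Z /\ (D%:Z %| (alpha ^+ n).2 - n%:Z)%Z.
Proof.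
elim: n => [|n [/dvdzP[a aE] /dvdzP[b bE]]]; first by rewrite expr0 dvdz0.
rewrite alpha_exp1S alpha_exp2S; split; apply/dvdzP.
  by exists (a - (alpha ^+ n).2); rewrite mulrBl -aE; ring.
by exists (a + b); rewrite mulrDl -aE -bE intS; ring.
Qed.

(** Modulo [D + 1], [sqrtmD] squares to 1, so [alpha ^ 2 = 2 alpha]. *)
Lemma alpha_exp_modD1 n :
  ((1 + D)%:Z %| (alpha ^+ n.+1).1 - 2 ^+ n)%Z
  /\ ((1 + D)%:Z %| (alpha ^+ n.+1).2 - 2 ^+ n)%Z.
Proof.
elim: n => [|n [/dvdzP[a aE] /dvdzP[b bE]]]; first by rewrite expr1 dvdz0.
rewrite (alpha_exp1S n.+1) (alpha_exp2S n.+1) (exprS 2%:Z n); split; apply/dvdzP.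
  exists (a + b - (alpha ^+ n.+1).2).
  by rewrite mulrBl mulrDl -aE -bE PoszD; ring.
by exists (a + b); rewrite mulrDl -aE -bE; ring.
Qed.

(** Each middle binomial term has one [p] from its coefficient and one from [sqrtmD ^ 2 = - D]; the
    last term contains [sqrtmD ^ 4] because [p > 3]. *)
Lemma alpha_exp_prime p : prime p -> (3 < p)%N -> (p %| D)%N ->
  exists w, alpha ^+ p = 1 + p%:R * (sqrtmD + p%:R * w).
Proof.
case: p => [|[|p']] //; set p := p'.+2 => p_pr p3 /dvdnP[c Dc].
pose P (z : zsqrt (- D%:Z)) := exists w, z = p%:R ^+ 2 * w.
have s2 : sqrtmD ^+ 2 = p%:R * (- c%:R).
  rewrite mulrN -natrM mulnC -Dc expr2 zsqrt_nat.
  by congr pair => /=; ring.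
suff [w E] : P (alpha ^+ p - 1 - p%:R * sqrtmD).
  by exists w; apply: (addIr (- 1 - p%:R * sqrtmD)); rewrite addrA E; ring.
rewrite alphaE exprDn big_ord_recl [in X in _ + X - _ - _]/p big_ord_recl -/p.
rewrite /= bin0 bin1 !expr1n expr0 expr1 !mul1r mulr1n.
set S := \sum_(i < _) _.
rewrite [X in P X](_ : _ = S); last by rewrite -mulr_natl; ring.
apply: (big_ind P); first by exists 0; rewrite mulr0.
  by move=> _ _ [u ->] [v ->]; exists (u + v); rewrite mulrDr.
move=> [i ip] _ /=.
rewrite expr1n mul1r.
have -> : (bump 0 (bump 0 i)) = i.+2 by rewrite /bump /=; lia.
have [ip2|ip2] := ltnP i.+2 p.
  have /dvdnP[b ->] := @prime_dvd_bin i.+2 p p_pr ip2.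
  exists (b%:R * - c%:R * sqrtmD ^+ i).
  by rewrite -addn2 exprD s2 -mulr_natl natrM; ring.
have pE : p = i.+2 by lia.
rewrite -pE binn mulr1n; exists (c%:R ^+ 2 * sqrtmD ^+ (p - 4)).
have -> : sqrtmD ^+ p = (sqrtmD ^+ 2) ^+ 2 * sqrtmD ^+ (p - 4).
  by rewrite -exprM -exprD; congr (_ ^+ _); lia.
by rewrite s2; ring.
Qed.

End Alpha.

(** * Local exclusion of second coordinates 1 and -1 *)

Lemma dvdn_sqr_bin2 p : prime p -> (2 < p)%N -> (p ^ 2 %| 'C(p, 2) * p)%N.
Proof.
by move=> p_pr p2; rewrite expnS expn1 dvdn_pmul2r ?prime_gt0 // prime_dvd_bin.
Qed.

(** The first-order term is [alpha * sqrtmD] modulo [p], with second coordinate 1. *)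
Lemma alpha_snd_neq1_prime D p m :
    prime p -> (3 < p)%N -> (p %| D)%N -> (0 < m)%N ->
  (alpha D ^+ (p * m).+1).2 <> 1.
Proof.
move=> p_pr p3 pD m0; have [w E] := alpha_exp_prime p_pr p3 pD.
rewrite exprS exprM E => H.
have := @snd_exp_stationary _ p p m (alpha D) (sqrtmD D + p%:R * w) p_pr
  (prime_gt0 p_pr) (dvdnn p) (dvdn_sqr_bin2 p_pr (ltnW p3)) m0 H.
rewrite zsqrtM2 zsqrtD1 zsqrtD2 (zsqrtM1 p%:R) (zsqrtM2 p%:R) !zsqrt_nat /=.
move=> /dvdzP[c].
have pz : (3 < p%:Z) by lia.
set u := w.1; set v := w.2 => cE.
have : (p%:Z %| 1)%Z by apply/dvdzP; exists (c - u - v); lia.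
by rewrite /dvdz => /dvdn_leq; lia.
Qed.

Lemma alpha_snd_negN1 D h : (D %% 4)%N = 2%N -> (alpha D ^+ (2 * h).+1).2 <> -1.
Proof.
move=> D2 E; have [_] := alpha_exp_modD1 D (2 * h); rewrite E => H.
have : ((1 + D)%:Z %| (2 ^+ h) ^+ 2 + 1)%Z.
  by rewrite -exprM mulnC -dvdzN opprD addrC.
by apply/negP/not_dvdz_sqrD1; lia.
Qed.

Lemma alpha_snd1_D2 D n :
  (D %% 4)%N = 2%N -> (0 < n)%N -> (alpha D ^+ n.+1).2 = 1 -> D = 2%N.
Proof.
move=> D2 n0 E.
have Dn : (D %| n)%N.
  have [_] := alpha_exp_modD D n.+1; rewrite E.
  by rewrite intS opprD addrA subrr sub0r dvdzN.
have big_prime p : prime p -> (3 < p)%N -> ~~ (p %| D)%N.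
  move=> p_pr p3; apply/negP => pD.
  have /dvdnP[m mE] := dvdn_trans pD Dn.
  have m0 : (0 < m)%N by lia.
  by apply: (alpha_snd_neq1_prime p_pr p3 pD m0); rewrite mulnC -mE.
have cofactor c : odd c -> (c %| D)%N -> ~~ (3 %| c)%N -> c = 1%N.
  move=> c_odd cD c3; apply/eqP/negPn/negP => c1.
  have c_gt1 : (1 < c)%N by case: c c_odd c1 {cD c3} => [|[]].
  have p_pr := pdiv_prime c_gt1; have pc := pdiv_dvd c.
  have p3 : ~~ (3 < pdiv c)%N.
    by apply/negP => /(big_prime _ p_pr); rewrite (dvdn_trans pc cD).
  have := prime_gt1 p_pr.
  case: (pdiv c) pc p3 => [|[|[|[|m]]]] // pc _ _; first by lia.
  by rewrite pc in c3.
have [/dvdnP[d dE]|D3] := boolP (3 %| D)%N; last first.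
  have := cofactor (D %/ 2)%N; rewrite dvdn_div; last by lia.
  by move=> H; lia.
have /dvdnP[m mE] : (3 %| n)%N by apply: dvdn_trans Dn; rewrite dE dvdn_mull.
have m0 : (0 < m)%N by lia.
pose t : zsqrt (- D%:Z) := (- D%:Z, 1 - d%:Z).
have E3 : alpha D ^+ 3 = 1 + 3%:R * t.
  rewrite alpha_exp3 zsqrt_nat; congr pair; rewrite /t /=; first by ring.
  by rewrite dE PoszM; ring.
have := @snd_exp_stationary _ 3 3 m (alpha D) t isT isT isT isT m0.
rewrite -E3 -exprM -exprS mulnC -mE => /(_ E); rewrite zsqrtM2 /= => /dvdzP[e eE].
(* Stationarity gives [3 | 1 - 4 d]. So [D / 6] is odd and prime to 3, hence 1; but then [d = 2], a
   contradiction. *)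
have := cofactor (D %/ 6)%N.
have -> : (D %/ 6 %| D)%N by apply/dvdnP; exists 6%N; lia.
lia.
Qed.

Lemma alpha_exp_stationary D m g t :
    alpha D ^+ 4 = 1 + 4%:R * t -> (0 < m)%N -> (g * alpha D ^+ (4 * m)).2 = g.2 ->
  (2 %| (g * t).2)%Z.
Proof. by rewrite exprM => -> m0; apply: snd_exp_stationary. Qed.

Lemma alpha2_snd1 h : (0 < h)%N -> (alpha 2 ^+ (2 * h).+1).2 = 1 -> h = 1%N.
Proof.
move=> h0 E.
pose t : zsqrt (- 2%:Z) := (- 2, - 1).
have E4 : alpha 2 ^+ 4 = 1 + 4%:R * t by rewrite alpha_exp4 zsqrt_nat.
(* According to [r] modulo 4, compare with [y_1 = 1] or [y_3 = 1]; in both cases [(g t).2] is odd,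
   so [m = 0]. *)
have [m hE] : exists m, h = (2 * m)%N \/ h = (2 * m).+1.
  by exists (h %/ 2)%N; lia.
case: hE => hE.
  have m0 : (0 < m)%N by lia.
  have := @alpha_exp_stationary _ m (alpha 2) _ E4 m0.
  rewrite -exprS (_ : (4 * m).+1 = (2 * h).+1); last by lia.
  by rewrite E => /(_ erefl).
have [m0|m0] := posnP m; first by lia.
have := @alpha_exp_stationary _ m (alpha 2 ^+ 3) _ E4 m0.
rewrite -exprD (_ : (3 + 4 * m)%N = (2 * h).+1); last by lia.
by rewrite E alpha_exp3 => /(_ erefl).
Qed.

Lemma alpha4_sndN1 h : (alpha 4 ^+ (2 * h).+1).2 = -1 -> h = 1%N.
Proof.
move=> E.
pose t : zsqrt (- 4%:Z) := (- 2, - 3).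
have E4 : alpha 4 ^+ 4 = 1 + 4%:R * t by rewrite alpha_exp4 zsqrt_nat.
(* Here [r = -1] modulo 4, so the only comparison is with [y_3 = -1]. *)
have [_] := alpha_exp_modD 4 (2 * h).+1; rewrite E => /dvdzP[c cE].
have [m hE] : exists m, h = (2 * m).+1 by exists (h %/ 2)%N; lia.
have [m0|m0] := posnP m; first by lia.
have := @alpha_exp_stationary _ m (alpha 4 ^+ 3) _ E4 m0.
rewrite -exprD (_ : (3 + 4 * m)%N = (2 * h).+1); last by lia.
by rewrite E alpha_exp3 => /(_ erefl).
Qed.

Lemma alpha_snd_neq1_mod4 D h :
  (D %% 4)%N = 0%N -> (0 < h)%N -> (alpha D ^+ (2 * h).+1).2 <> 1.
Proof.
move=> D4 h0 E.
have /dvdnP[d dE] : (4 %| D)%N by rewrite /dvdn D4.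
have [_] := alpha_exp_modD D (2 * h).+1; rewrite E => /dvdzP[c cE].
have [m hE] : exists m, h = (2 * m)%N.
  by exists (h %/ 2)%N; rewrite dE PoszM in cE; lia.
pose t : zsqrt (- D%:Z) := (4 * d%:Z ^+ 2 - 6 * d%:Z, 1 - 4 * d%:Z).
have E4 : alpha D ^+ 4 = 1 + 4%:R * t.
  by rewrite alpha_exp4 zsqrt_nat; congr pair; rewrite /t /= dE PoszM; ring.
have m0 : (0 < m)%N by lia.
have := @alpha_exp_stationary _ m (alpha D) _ E4 m0.
rewrite -exprS (_ : (4 * m).+1 = (2 * h).+1); last by lia.
by rewrite E zsqrtM2 /= => /(_ erefl) /dvdzP[e]; lia.
Qed.

(** * Second coordinate -1 with [D + 1] a prime power *)

Lemma alpha_sndN1_exp_modD1 D h :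
    (alpha D ^+ (2 * h).+1).2 = -1 -> odd h ->
  ((1 + D)%:Z %| (- 4) ^+ h - 1)%Z.
Proof.
move=> E h_odd; have [_] := alpha_exp_modD1 D (2 * h); rewrite E.
rewrite exprNn -signr_odd h_odd expr1 mulN1r exprM.
by rewrite [X in (_ %| X)%Z](_ : _ = - 4 ^+ h - 1) //; ring.
Qed.

Lemma alpha_sndN1_prime_power D h p k :
    (D %% 4)%N = 0%N -> (0 < D)%N -> prime p -> (0 < k)%N -> (1 + D)%N = (p ^ k)%N ->
    (alpha D ^+ (2 * h).+1).2 = -1 ->
  D = 4%N.
Proof.
move=> D4 D0 p_pr k0 qE E.
have p_gt1 := prime_gt1 p_pr.
have p_odd : odd p.
  have : odd (p ^ k)%N by rewrite -qE; lia.
  by rewrite oddX; lia.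
have pq : (p %| 1 + D)%N by rewrite qE dvdn_exp.
have Dh : (D %| 2 * h + 2)%N.
  have [_] := alpha_exp_modD D (2 * h).+1; rewrite E -dvdzN.
  by rewrite [X in (_ %| X)%Z](_ : _ = (2 * h + 2)%N%:Z) //; lia.
have h_odd : odd h.
  have /dvdnP[c cE] : (4 %| 2 * h + 2)%N.
    by apply: dvdn_trans Dh; rewrite /dvdn D4.
  by lia.
have hD : coprime h D.
  have g2 : (gcdn h D %| 2)%N.
    rewrite -(dvdn_addr _ (dvdn_mull 2 (dvdn_gcdl h D))).
    exact: dvdn_trans (dvdn_gcdr h D) Dh.
  have gh := dvdn_gcdl h D; rewrite /coprime.
  case: (gcdn h D) g2 gh => [|[|[|g]]] // _; lia.
have p1D : (p.-1 %| D)%N.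
  have -> : D = (p ^ k).-1 by rewrite -qE.
  by rewrite predn_exp dvdn_mulr.
have h4 := alpha_sndN1_exp_modD1 E h_odd.
have p5 : p = 5%N.
  have pN5 : (p%:Z %| - 4 - 1)%Z.
    have cop : coprime p.-1 h by rewrite coprime_sym (coprime_dvdr p1D).
    apply: (dvdz_exp_coprime _ cop); first by lia.
      have -> : (- 4) ^+ p.-1 = 4%:Z ^+ p.-1.
        by rewrite exprNn -signr_odd (_ : odd p.-1 = false) ?mul1r //; lia.
      by apply: dvdz_fermat => //; rewrite (coprimeXl 2 (m := 2)) // coprime2n.
    exact: dvdz_trans h4.
  have : (p %| 5)%N by [].
  by rewrite dvdn_prime2 // => /eqP.
subst p.
have [k1|k1] := leqP k 1.
  by have k1' : k = 1%N; [lia | rewrite k1' in qE; lia].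
have /dvdnP[h' hE] : (5 %| h)%N.
  have q25 : (25 %| 1 + D)%N by rewrite qE (dvdn_exp2l 5 k1).
  have : (25%:Z %| (- 4) ^+ h - 1)%Z by apply: dvdz_trans h4.
  (* Modulo 25, [(1 - 5) ^ h = 1 - 5 h]. *)
  rewrite (_ : - 4 = 1 + - 5) //.
  have [w ->] := expr1D_order3 (- 5 : int) h.
  by move=> /dvdzP[c]; lia.
have := E; rewrite alpha_exp_odd_snd => Pell.
set x := (alpha D ^+ h).1 + _ in Pell; set y := (alpha D ^+ h).2 in Pell.
have [m kE] : exists m, k = (2 * m)%N \/ k = (2 * m).+1 by exists (k %/ 2)%N; lia.
have m0 : (0 < m)%N by lia.
have [w wE] : exists w, (5 ^ m = 5 * w)%N.
  by exists (5 ^ m.-1)%N; rewrite -expnS prednK.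
have w0 : (0 < w)%N by have : (0 < 5 ^ m)%N; [rewrite expn_gt0 | lia].
case: kE => kE; rewrite qE kE in Pell.
  rewrite (mulnC 2) expnM wE PoszX PoszM -exprMn in Pell.
  (* For even [k], Pell reads [(5 z - x) (5 z + x) = 1]: both factors are the same unit, so [10 z]
     would be 2 or -2. *)
  set z := w%:Z * y.
  have /dvdzP : exists c, 1 = c * (5 * z - x).
    by exists (5 * z + x); rewrite -[LHS]opprK -Pell /z; ring.
  rewrite dvdzE dvdn1 => /eqP d1.
  have : (5 * z - x) * (5 * z + x) = 1 by rewrite -[RHS]opprK -Pell /z; ring.
  have : 5 * z - x = 1 \/ 5 * z - x = -1 by move: (5 * z - x) d1; clear; lia.
  by case=> e; rewrite e; move: e; clear; lia.
(* With [v = 5 ^ m = 2 u + 1], the two factors of [y_5] become [20 u ^ 2 - 1] and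
   [20 (u + 1) ^ 2 - 1]. *)
have [u vE] : exists u, (5 ^ m = (2 * u).+1)%N.
  have odd5m : odd (5 ^ m) by rewrite oddX orbT.
  by exists (5 ^ m %/ 2)%N; move: (5 ^ m)%N odd5m; clear; lia.
have u2 : (0 < u ^ 2)%N.
  by rewrite expn_gt0; move: wE w0; rewrite vE; clear; lia.
have DE : D%:Z = 5 * (2 * u%:Z + 1) ^+ 2 - 1.
  have := congr1 Posz qE; rewrite kE expnS (mulnC 2) expnM vE PoszD PoszM PoszX.
  by rewrite (intS (2 * u)) PoszM => e; apply: (addrI 1%:Z); rewrite e; ring.
have qy : ((20 * u ^ 2 - 1)%N%:Z %| x ^+ 2 + 1)%Z.
  have y5 : ((alpha D ^+ 5).2 %| y)%Z.
    by rewrite /y hE mulnC exprM dvdz_snd_exp.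
  move/eqP: Pell; rewrite subr_eq => /eqP ->.
  rewrite addrAC addNr add0r; apply/dvdz_mull/dvdz_mulr; apply: dvdz_trans y5.
  rewrite alpha_exp5_snd DE; apply/dvdzP; exists (20 * (u%:Z + 1) ^+ 2 - 1).
  have -> : (20 * u ^ 2 - 1)%N%:Z = 20%:Z * u%:Z ^+ 2 - 1%:Z.
    by rewrite -PoszX -PoszM subzn // muln_gt0.
  by ring.
have q3 : ((20 * u ^ 2 - 1) %% 4)%N = 3%N by move: (u ^ 2)%N u2; clear; lia.
by have := not_dvdz_sqrD1 x q3; rewrite qy.
Qed.

(** * Transfer to the complex numbers *)

Section Embedding.

Variables (R : realType) (D : nat) (s : R[i]).
Hypothesis sqr_s : s ^+ 2 = - D%:R.

Lemma alpha_expE r :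
  (1 + s) ^+ r = (alpha D ^+ r).1%:~R + (alpha D ^+ r).2%:~R * s.
Proof.
elim: r => [|r IH]; first by rewrite !expr0 /= mul0r addr0.
rewrite exprS IH alpha_exp1S alpha_exp2S rmorphB rmorphM rmorphD /= -pmulrn.
have -> : (D%:R : R[i]) = - s ^+ 2 by rewrite sqr_s opprK.
by ring.
Qed.

(** Squaring [(b - e) s = c - a] gives [- D (b - e) ^ 2 = (c - a) ^ 2], of opposite signs unless
    [b = e]. *)
Lemma snd_unique (a b c e : int) : (0 < D)%N ->
  a%:~R + b%:~R * s = c%:~R + e%:~R * s -> b = e.
Proof.
move=> D0 E.
have E2 : (b - e)%:~R * s = (c - a)%:~R.
  have -> : (b - e)%:~R * s = (a%:~R + b%:~R * s) - a%:~R - e%:~R * s by ring.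
  by rewrite E; ring.
have : ((b - e)%:~R * s) ^+ 2 = (c - a)%:~R ^+ 2 by rewrite E2.
rewrite exprMn sqr_s pmulrn -rmorphN -!rmorphXn -rmorphM /=.
move=> /(mulrIz (oner_neq0 _)) H.
apply/eqP; rewrite -subr_eq0; apply: contraT => be.
have be2 : 0 < (b - e) ^+ 2 by rewrite exprn_even_gt0.
have := sqr_ge0 (c - a); rewrite -H.
by move: ((b - e) ^+ 2) be2 => z; nia.
Qed.

Lemma is_solution_snd r : (0 < D)%N ->
  (exists a, is_solution s r a) <->
  (alpha D ^+ r).2 = 1 \/ (alpha D ^+ r).2 = -1.
Proof.
move=> D0; rewrite /is_solution alpha_expE; split.
  move=> [a [H|H]]; [left | right].
    by apply: (@snd_unique (alpha D ^+ r).1 _ a 1 D0); rewrite H mul1r.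
  by apply: (@snd_unique (alpha D ^+ r).1 _ a (-1) D0); rewrite H mulN1r.
by move=> [->|->]; exists (alpha D ^+ r).1; [left | right];
  rewrite ?mulN1r ?mul1r.
Qed.

End Embedding.

Theorem lemma3p2 (R : realType) (D : nat) (s : R[i])
    (D_gt0 : (0 < D)%N) (sqr_s : s ^+ 2 = - D%:R) :
  (D = 2 %[mod 4] ->
     forall r : nat, (1 < r)%N ->
       ((exists a : int, is_solution s r a) <-> D = 2%N /\ r = 3%N))
  /\
  (D = 0 %[mod 4] -> prime (1 + D) \/ prime_power (1 + D) ->
     forall r : nat, (1 < r)%N ->
       ((exists a : int, is_solution s r a) <-> D = 4%N /\ r = 3%N)).
Proof.
have odd_exp r : (1 < r)%N -> (alpha D ^+ r).2 = 1 \/ (alpha D ^+ r).2 = -1 ->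
    exists2 h, (0 < h)%N & r = (2 * h).+1.
  move=> r1 E; have [r_odd|r_even] := boolP (odd r).
    by exists (r %/ 2)%N; lia.
  have rE : r = (2 * (r %/ 2))%N by lia.
  by move: E; rewrite rE alpha_exp_double_snd; lia.
split=> [D2 | D4 qD] r r1; rewrite (is_solution_snd sqr_s r D_gt0).
  split=> [E | [-> ->]]; last by rewrite alpha_exp3; left.
  have [h h0 rE] := odd_exp r r1 E; rewrite rE in E *.
  case: E => E; last by case: (alpha_snd_negN1 D2 E).
  have h20 : (0 < 2 * h)%N by lia.
  have DE := alpha_snd1_D2 D2 h20 E.
  by rewrite DE in E *; rewrite (alpha2_snd1 h0 E).
split=> [E | [-> ->]]; last by rewrite alpha_exp3; right.
have [h h0 rE] := odd_exp r r1 E; rewrite rE in E *.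
case: E => E; first by case: (alpha_snd_neq1_mod4 D4 h0 E).
have [p [k [p_pr k0 qE]]] : prime_power (1 + D).
  by case: qD => // q_pr; exists (1 + D)%N, 1%N; rewrite expn1.
have DE := alpha_sndN1_prime_power D4 D_gt0 p_pr k0 qE E.
by rewrite DE in E *; rewrite (alpha4_sndN1 E).
Qed.
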